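(* For every positive integer $n$, $$3S_n\equiv 0\pmod{2n+3},$$ where $S_n=\dfrac{\binom{6n}{3n}\binom{3n}{n}}{2(2n+1)\binom{2n}{n}}$.
   Context: For a positive integer $n$, $S_n=\dfrac{\binom{6n}{3n}\binom{3n}{n}}{2(2n+1)\binom{2n}{n}}$. It is a previously known result (Z.-W. Sun) that $S_n$ is an integer for every positive integer $n$; the congruence is between integers. *)

(* Defs.v *)
From mathcomp Require Import all_boot all_order all_algebra.

Set Implicit Arguments.
Unset Strict Implicit.
Unset Printing Implicit Defensive.

Import GRing.Theory.
Local Open Scope ring_scope.

(* Exact quotient in the rationals; its integrality is not built in. *)
Definition sunS (n : nat) : rat :=
  ('C(6 * n, 3 * n)%:R * 'C(3 * n, n)%:R)
    / (2 * (2 * n%:R + 1) * 'C(2 * n, n)%:R).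

(* Main.v *)
Require Import Defs.
From mathcomp Require Import all_boot all_order all_algebra.
From mathcomp Require Import ring zify.

Set Implicit Arguments.
Unset Strict Implicit.
Unset Printing Implicit Defensive.

Import GRing.Theory.
Local Open Scope ring_scope.

(** The quotient A = C(6n,3n) C(3n,n) / C(2n,n) is the coefficient of x^(2n) in
    (1 - 4x)^(-(n + 1/2)).  Write f(a,k) for the coefficient of x^k in
    (1 - 4x)^(-(a + 1/2)): it is an integer, even for k > 0, and differentiating
    the series gives (k+1) f(a,k+1) = 2 (2a+1) f(a+1,k).  Hence
    n A = (2n+1) f(n+1,2n-1), so that 2n+1 divides A, and
    2n (2n-1) A = 4 (2n+1) (2n+3) f(n+2,2n-2).  Since 2n (2n-1) = 12 modulo 2n+3,
    the odd number 2n+3 divides 3 A. *)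

Fixpoint half_coef (a : nat) : nat -> nat :=
  if a is a'.+1 then
    fix coef_a k :=
      if k is k'.+1 then (half_coef a' k + 4 * coef_a k')%N else 1%N
  else fun k => 'C(2 * k, k).

(** Multiplication by 1 - 4x turns the series for a+1 into the series for a. The nested fixpoint
    encodes this recurrence from the central binomials of (1 - 4x)^(-1/2), so the coefficients are
    integers by construction. *)
Lemma half_coefS a k :
  half_coef a.+1 k.+1 = (half_coef a k.+1 + 4 * half_coef a.+1 k)%N.
Proof. by []. Qed.

Lemma half_coef_k0 a : half_coef a 0 = 1%N.
Proof. by case: a. Qed.

(** In row 0, Pascal's rule and symmetry give two equal summands; the recurrence then adds multiples
    of 4. *)
Lemma half_coef_even a k : (2 %| half_coef a k.+1)%N.
Proof.
elim: a k => [|a IHa] k.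
  rewrite /= mulnS add2n binS -[in X in (_ %| _ + X)%N]bin_sub; last by lia.
  by rewrite (_ : ((2 * k).+1 - k = k.+1)%N) ?addnn -?mul2n ?dvdn_mulr //; lia.
by rewrite half_coefS dvdn_add // dvdn_mulr.
Qed.

(** Closed form with denominators cleared, by double induction along the recurrence; it replaces all
    manipulation of series below. *)
Lemma half_coef_fact a k :
  (half_coef a k * (k`! * (2 * a)`! * (a + k)`!) = (2 * (a + k))`! * a`!)%N.
Proof.
elim: a k => [|a IHa] k.
  have := @bin_fact (2 * k) k; rewrite (_ : (2 * k - k = k)%N); last by lia.
  by rewrite /= !add0n fact0 !muln1 => ->; lia.
elim: k => [|k IHk].
  by rewrite half_coef_k0 !addn0 fact0 !mul1n.
have := IHa k.+1; move: IHk; rewrite half_coefS.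
have -> : (a.+1 + k.+1 = (a + k).+2)%N by lia.
have -> : (a + k.+1 = (a + k).+1)%N by lia.
have -> : (a.+1 + k = (a + k).+1)%N by lia.
rewrite [(2 * (a + k).+2)%N]mulnS add2n [(2 * a.+1)%N]mulnS add2n.
set N := (2 * (a + k).+1)%N.
rewrite (factS N.+1) (factS N) (factS (2 * a).+1) (factS (2 * a)).
rewrite (factS (a + k).+1) (factS k) (factS a).
set x := half_coef a.+1 k; set y := half_coef a k.+1.
move: (N`!) (k`!) ((2 * a)`!) ((a + k).+1`!) (a`!) => F K A M B Hx Hy.
rewrite {}/N in Hx Hy *.
(* Each summand is arranged to contain the left side of one induction hypothesis. *)
have -> : ((y + 4 * x) * (k.+1 * K * ((2 * a).+2 * ((2 * a).+1 * A)) *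
            ((a + k).+2 * M)) =
   (2 * a).+2 * (2 * a).+1 * (a + k).+2 * (y * (k.+1 * K * A * M)) +
   4 * k.+1 * (a + k).+2 *
      (x * (K * ((2 * a).+2 * ((2 * a).+1 * A)) * M)))%N by ring.
rewrite Hx Hy; ring.
Qed.

(** The closed forms at (a, k+1) and (a+1, k) have the same index sum, hence the same factorial
    (2(a+k+1))!, and can be compared. *)
Lemma half_coef_shift a k :
  (k.+1 * half_coef a k.+1 = 2 * (2 * a).+1 * half_coef a.+1 k)%N.
Proof.
have := half_coef_fact a k.+1; have := half_coef_fact a.+1 k.
have -> : (a.+1 + k = a + k.+1)%N by lia.
rewrite [(2 * a.+1)%N]mulnS add2n !factS => Hx Hy.
have := fact_gt0 k; have := fact_gt0 (2 * a); have := fact_gt0 (a + k.+1).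
move: (k`!) ((2 * a)`!) ((a + k.+1)`!) Hx Hy => K A M Hx Hy M0 A0 K0.
apply/eqP; rewrite -(@eqn_pmul2r (a.+1 * (K * A * M))); last first.
  by rewrite !muln_gt0 M0 A0 K0.
apply/eqP; transitivity (a.+1 * (half_coef a k.+1 * (k.+1 * K * A * M)))%N.
  by ring.
rewrite Hy mulnCA -Hx; ring.
Qed.

Lemma half_coef_diag n :
  ('C(6 * n, 3 * n) * 'C(3 * n, n) = half_coef n (2 * n) * 'C(2 * n, n))%N.
Proof.
have := half_coef_fact n (2 * n).
have -> : (n + 2 * n = 3 * n)%N by lia.
have -> : (2 * (3 * n) = 6 * n)%N by lia.
have := @bin_fact (6 * n) (3 * n); have := @bin_fact (3 * n) n.
have := @bin_fact (2 * n) n.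
have -> : (6 * n - 3 * n = 3 * n)%N by lia.
have -> : (3 * n - n = 2 * n)%N by lia.
have -> : (2 * n - n = n)%N by lia.
move=> /(_ ltac:(lia)) H2 /(_ ltac:(lia)) H3 /(_ ltac:(lia)) H6 HA.
have := fact_gt0 n; have := fact_gt0 (2 * n); have := fact_gt0 (3 * n).
move: H2 H3 H6 HA.
move: (n`!) ((2 * n)`!) ((3 * n)`!) ((6 * n)`!) => F1 F2 F3 F6.
move=> H2 H3 H6 HA F3_gt0 F2_gt0 F1_gt0.
apply/eqP; rewrite -(@eqn_pmul2r (F3 * F3 * (F1 * F2) * F1)); last first.
  by rewrite !muln_gt0 F1_gt0 F2_gt0 F3_gt0.
set c6 := 'C(6 * n, _) in H6 *; set c3 := 'C(3 * n, _) in H3 *.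
set c2 := 'C(2 * n, _) in H2 *; set A := half_coef _ _ in HA *.
apply/eqP; transitivity ((c6 * (F3 * F3)) * (c3 * (F1 * F2)) * F1)%N.
  by ring.
rewrite H6 H3 mulnAC -HA -{1}H2; ring.
Qed.

Lemma dvdn_half_coef_diag n :
  (0 < n)%N -> (2 * (2 * n).+1 %| half_coef n (2 * n))%N.
Proof.
case: n => // n _; set a := n.+1.
rewrite Gauss_dvd; last by rewrite coprime2n mul2n /= odd_double.
have e : (2 * a = (2 * n).+2)%N by rewrite /a; lia.
apply/andP; split; first by rewrite e half_coef_even.
(* By coprimality it suffices to divide 2a f(a,2a), to which the shift applies. *)
have cop : coprime (2 * a).+1 (2 * a) by rewrite coprimeSn.
rewrite -(Gauss_dvdr _ cop) {2 3}e half_coef_shift.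
by rewrite mulnAC dvdn_mull.
Qed.

Lemma dvdn_half_coef_diag3 n :
  (0 < n)%N -> (2 * n + 3 %| 3 * half_coef n (2 * n))%N.
Proof.
case: n => // n _; set a := n.+1.
have e : (2 * a = (2 * n).+2)%N by rewrite /a; lia.
have cop : coprime (2 * a + 3) 4.
  by rewrite (@coprime_pexpr 2 _ 2) // coprimen2; lia.
rewrite -(Gauss_dvdr _ cop).
(* Two shifts, (a, 2a) to (a+1, 2a-1) to (a+2, 2a-2); here 2n = 2a-2. *)
have Hs : (2 * a * (2 * n).+1 * half_coef a (2 * a) =
    4 * (2 * a).+1 * (2 * a + 3) * half_coef a.+2 (2 * n))%N.
  rewrite {1 2}e mulnAC half_coef_shift.
  rewrite -mulnA [(_ * (2 * n).+1)%N]mulnC half_coef_shift.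
  by rewrite /a; ring.
(* With m = 2a+3, this is 2a(2a-1) = (m-3)(m-4) = m^2 - 7m + 12, rearranged to avoid subtraction in
   [nat]. *)
have Hm : ((2 * a + 3) * ((2 * a + 3) * half_coef a (2 * a)) +
     4 * (3 * half_coef a (2 * a)) =
    (2 * a + 3) * (7 * half_coef a (2 * a)) +
     2 * a * (2 * n).+1 * half_coef a (2 * a))%N.
  by move: (half_coef _ _) => A; rewrite e; ring.
rewrite -(@dvdn_addr ((2 * a + 3) * ((2 * a + 3) * half_coef a (2 * a)))%N);
  last exact: dvdn_mulr.
by rewrite Hm Hs; apply: dvdn_add; [exact: dvdn_mulr | exact/dvdn_mulr/dvdn_mull].
Qed.

Theorem theorem1p1 (n : nat) (n_gt0 : (0 < n)%N) :
  exists2 s : int, s%:~R = sunS n & (3 * s = 0 %[mod 2 * n%:Z + 3])%Z.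
Proof.
have /dvdnP [s As] := dvdn_half_coef_diag n_gt0.
exists s%:Z.
  have C0 : 'C(2 * n, n)%:R != 0 :> rat.
    by rewrite Num.Theory.pnatr_eq0 -lt0n bin_gt0; lia.
  have D0 : (2 * n).+1%:R != 0 :> rat by rewrite Num.Theory.pnatr_eq0.
  rewrite /sunS -natrM half_coef_diag As !natrM.
  have -> : 2 * n%:R + 1 = (2 * n).+1%:R :> rat by rewrite -natr1; ring.
  rewrite -pmulrn; move: (_.+1%:R) ('C(_, _)%:R) D0 C0 => d c d0 c0.
  by field; rewrite d0 c0.
(* 2n+3 is odd and exceeds 2n+1 by 2, so the factor 2(2n+1) cancels from 3A = 3s * 2(2n+1). *)
have cop : coprime (2 * n + 3) (2 * (2 * n).+1).
  rewrite coprimeMr coprimen2 (_ : (2 * n + 3 = 2 + (2 * n).+1)%N); last by lia.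
  by rewrite [coprime _ _.+1]coprime_sym /coprime gcdnDr -/(coprime _ _) coprimen2; lia.
apply/eqP; rewrite eqz_mod_dvd subr0.
have := dvdn_half_coef_diag3 n_gt0.
by rewrite As mulnA Gauss_dvdl.
Qed.
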